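(* Consider the borrowed betting game with gross wealth $\{W_t\}_{t\ge0}$, borrowings $\{\beta_t\}_{t\ge 1}$, and total leverage penalty $\{P_t\}$. The leverage-penalized gross wealth process $\{W_t/P_t\}$ is a nonnegative supermartingale under the supermartingale null $\mathbb{P}_{\mathsf S}$ and a martingale under the martingale null $\mathbb{P}_{\mathsf M}$. Consequently, $$\mathbb{P}_{\mathsf S}\left(\exists t,\ W_t\ge P_t/\alpha\right)\le\alpha$$ for any $\alpha\in(0,1)$.
   Context: Borrowed betting game. Let $(\Omega,\mathcal{A},\mathbb{P})$ be a probability space with a discrete-time filtration $\{\mathcal{F}_t\}_{t\ge0}$. Let $\{B_t\}_{t\ge1}$ be a nonnegative process adapted to $\{\mathcal{F}_t\}_{t\ge 1}$, and let $\{\beta_t\}_{t\ge1}$ be predictable with respect to $\{\mathcal{F}_t\}_{t\ge0}$ ($\beta_t$ is $\mathcal{F}_{t-1}$-measurable) with $\beta_t\ge -W_{t-1}$ for each $t$. The (gross) wealth process is $W_0=1$ and $W_t=(W_{t-1}+\beta_t)\cdot B_t$ for $t\ge1$. Supermartingale null: $\mathbb{E}(B_t\mid\mathcal{F}_{t-1})\le1$ for all $t\ge1$; the probability is then denoted $\mathbb{P}_{\mathsf S}$. Martingale null: $\mathbb{E}(B_t\mid\mathcal{F}_{t-1})=1$ for all $t\ge1$; the probability is then denoted $\mathbb{P}_{\mathsf M}$. Leverage penalty. The instantaneous leverage ratio before the bet $B_t$ is $\rho_t=(W_{t-1}+\beta_t)/W_{t-1}$, which is $\mathcal{F}_{t-1}$-measurable.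 The total leverage penalty up to time $t$ is the product $P_t=\rho_1\cdots\rho_t$ (with $P_0=1$, the empty product). The leverage-penalized gross wealth at time $t$ is $W_t/P_t$. In computing $\rho_t$ and $P_t$ it is stipulated that $\frac00:=1$ and $0\cdot\infty=\infty$. Under these stipulations the process $\{W_t/P_t\}$ is understood to drop to $0$ and stay $0$ forever once the gross wealth $W_t$ is emptied, either by $B_t=0$ or by $\beta_t=-W_{t-1}$.
   Formalization: The martingale claim additionally assumes that almost surely β_{t+1} > −W_t whenever W_t/P_t > 0 (no full withdrawal), and the event W_t ≥ P_t/α counts only times with P_t ≠ 0; with B=1, β_1=−1, β_t=0 afterwards, both claims fail as written. *)

(* Defs.v *)
From HB Require Import structures.
From mathcomp Require Import all_boot all_order all_algebra.
From mathcomp Require Import all_classical all_reals all_analysis.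
From mathcomp Require Import measurable_realfun.

Set Implicit Arguments.
Unset Strict Implicit.
Unset Printing Implicit Defensive.

Import Order.TTheory GRing.Theory Num.Theory.
Import numFieldNormedType.Exports.

Local Open Scope classical_set_scope.
Local Open Scope ring_scope.

Definition is_filtration d (T : measurableType d) (F : nat -> set (set T)) :=
  [/\ forall t, sigma_algebra setT (F t),
      forall t, F t `<=` measurable &
      forall s t, (s <= t)%N -> F s `<=` F t].

(* [g_sigma_algebraType G] has <<s G >> as its measurable sets, and this is G
   when G is a sigma-algebra. *)
Definition sub_measurable d (T : measurableType d) (G : set (set T))
    d' (U : measurableType d') (f : T -> U) :=
  measurable_fun setT (f : g_sigma_algebraType G -> U).

Section conditional_expectation.
Context d (T : measurableType d) (R : realType) (P : probability T R).
Local Open Scope ereal_scope.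

(* Y is a version of E(X | G), for X nonnegative or integrable. *)
Definition is_cond_exp (G : set (set T)) (X Y : T -> \bar R) :=
  sub_measurable G Y /\
  forall A, G A -> \int[P]_(w in A) Y w = \int[P]_(w in A) X w.

Definition cond_exp_le (G : set (set T)) (X Z : T -> \bar R) :=
  exists2 Y, is_cond_exp G X Y & {ae P, forall w, Y w <= Z w}.

Definition cond_exp_eq (G : set (set T)) (X Z : T -> \bar R) :=
  exists2 Y, is_cond_exp G X Y & {ae P, forall w, Y w = Z w}.

Definition supermartingale (F : nat -> set (set T)) (M : nat -> T -> \bar R) :=
  [/\ forall t, sub_measurable (F t) (M t),
      forall t, P.-integrable setT (M t) &
      forall t, cond_exp_le (F t) (M t.+1) (M t)].

Definition martingale (F : nat -> set (set T)) (M : nat -> T -> \bar R) :=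
  [/\ forall t, sub_measurable (F t) (M t),
      forall t, P.-integrable setT (M t) &
      forall t, cond_exp_eq (F t) (M t.+1) (M t)].

End conditional_expectation.

Section betting_game.
Context (T : Type) (R : realType).
(* B t and beta t are meaningful for t >= 1 only. *)
Variables (B beta : nat -> T -> R).

Fixpoint wealth (t : nat) (w : T) : R :=
  if t is s.+1 then (wealth s w + beta s.+1 w) * B s.+1 w else 1.

Local Open Scope ereal_scope.

(* Quotient of nonnegative reals with 0 / 0 := 1; the library's inverse gives
   x / 0 = +oo for x > 0. *)
Definition lev_div (x y : R) : \bar R :=
  if (x == 0%R) && (y == 0%R) then 1 else x%:E / y%:E.

(* Product on [0, +oo] with 0 * oo := oo, where the library has 0 * +oo = 0. *)
Definition lev_mul (x y : \bar R) : \bar R :=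
  if (x == +oo) || (y == +oo) then +oo else x * y.

Definition leverage (t : nat) (w : T) : \bar R :=
  lev_div (wealth t.-1 w + beta t w) (wealth t.-1 w).

Fixpoint penalty (t : nat) (w : T) : \bar R :=
  if t is s.+1 then lev_mul (penalty s w) (leverage s.+1 w) else 1.

(* With the library's conventions 0^-1 = +oo, +oo^-1 = 0 and 0 * +oo = 0, this
   quotient is 0 when the penalty is +oo and also when wealth and penalty are
   both 0: the stipulation 0 / 0 := 1 concerns the leverage ratios only, since
   the penalized wealth must vanish once the wealth has been emptied, see
   [penalized_wealth_stays0]. *)
Definition penalized_wealth (t : nat) (w : T) : \bar R :=
  (wealth t w)%:E / penalty t w.

Section facts.
Hypothesis B_ge0 : forall t w, (0 <= B t.+1 w)%R.
Hypothesis beta_ge : forall t w, (- wealth t w <= beta t.+1 w)%R.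

Lemma wealthD_ge0 t w : (0 <= wealth t w + beta t.+1 w)%R.
Proof. by have := beta_ge t w; rewrite -subr_ge0 opprK addrC. Qed.

Lemma wealth_ge0 t w : (0 <= wealth t w)%R.
Proof. by case: t => [|t] /=; rewrite ?ler01// mulr_ge0// wealthD_ge0. Qed.

Lemma leverage_ge0 t w : 0 <= leverage t.+1 w.
Proof.
rewrite /leverage /lev_div /=; case: ifP => // _.
by rewrite mule_ge0 ?lee_fin ?wealthD_ge0// inve_ge0 lee_fin wealth_ge0.
Qed.

Lemma penalty_ge0 t w : 0 <= penalty t w.
Proof.
elim: t => [|t IH] //=; rewrite /lev_mul; case: ifP => // _.
by rewrite mule_ge0// leverage_ge0.
Qed.

Lemma wealth_eq0_of_penalty t w : penalty t w = 0 -> wealth t w = 0%R.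
Proof.
elim: t => [/eqP|t IH] /=; first by rewrite onee_eq0.
rewrite /lev_mul; case: ifPn => // /norP[Py ly] /eqP.
rewrite mule_eq0 => /orP[/eqP/IH W0|].
- move: ly; rewrite /leverage /lev_div /= W0 eqxx add0r andbT.
  case: (eqVneq (beta t.+1 w) 0%R) => [-> _|b0]; first by rewrite mul0r.
  have b_gt0 : (0 < beta t.+1 w)%R.
    by rewrite lt_neqAle eq_sym b0; have := beta_ge t w; rewrite W0 oppr0.
  by rewrite inve0 gt0_muley ?lte_fin ?eqxx.
- rewrite /leverage /lev_div /=; case: ifPn => [_|_].
    by rewrite onee_eq0.
  by rewrite mule_eq0 eqe inve_eq0 orbF => /eqP ->; rewrite mul0r.
Qed.

Lemma penalized_wealth_stays0 t w :
  wealth t w = 0%R -> forall s, (t <= s)%N -> penalized_wealth s w = 0.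
Proof.
move=> Wt0 s /subnK <-; set k := (s - t)%N.
suff [W0|Py] : wealth (k + t) w = 0%R \/ penalty (k + t) w = +oo.
- by rewrite /penalized_wealth W0 mul0e.
- by rewrite /penalized_wealth Py invey mule0.
elim: k => [|k [W0|Py]]; first by left.
- have [b0|b0] := eqVneq (beta (k + t).+1 w) 0%R.
    by left; rewrite /= W0 b0 addr0 mul0r.
  have b_gt0 : (0 < beta (k + t).+1 w)%R.
    by rewrite lt_neqAle eq_sym b0; have := beta_ge (k + t) w; rewrite W0 oppr0.
  right; rewrite addSn /= /lev_mul /leverage /lev_div /= W0 add0r eqxx.
  by rewrite (negPf b0) /= inve0 gt0_muley ?lte_fin ?eqxx ?orbT.
- by right; rewrite addSn /= /lev_mul Py eqxx.
Qed.

Lemma penalty_crossing alpha t w : (0 < alpha)%R ->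
  penalty t w != 0 /\ penalty t w / alpha%:E <= (wealth t w)%:E <->
  (alpha^-1)%:E <= penalized_wealth t w.
Proof.
move=> a0; have ai0 : (0 < alpha^-1)%R by rewrite invr_gt0.
rewrite /penalized_wealth.
have [P0|Pn0] := eqVneq (penalty t w) 0.
  rewrite (wealth_eq0_of_penalty P0) mul0e.
  by split=> [[]//|]; rewrite lee_fin leNgt ai0.
rewrite inver gt_eqF//.
case: (penalty t w) (penalty_ge0 t w) Pn0 => [p| |] //.
  rewrite lee_fin eqe => p0 pn0; have {p0 pn0}p0 : (0 < p)%R.
    by rewrite lt_neqAle eq_sym pn0.
  rewrite inver gt_eqF// -!EFinM !lee_fin ler_pdivlMr// mulrC.
  by split=> [[]|].
move=> _ _; rewrite invey mule0 gt0_mulye ?lte_fin// leye_eq.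
by split=> [[]//|]; rewrite lee_fin leNgt ai0.
Qed.

End facts.

End betting_game.

(* Withdrawing the whole (positive) wealth, beta t = - W (t - 1), sends the
   penalized wealth to 0 whatever the bet is.  Hence under the martingale null
   the penalized wealth is in general only a supermartingale when such
   withdrawals happen with positive probability. *)
Section full_withdrawal.
Context d (T : measurableType d) (R : realType) (P : probability T R).
Variable F : nat -> set (set T).
Hypothesis hF : is_filtration F.

Let B (t : nat) (w : T) : R := 1.
Let beta (t : nat) (w : T) : R := if t == 1%N then -1 else 0.

Lemma full_withdrawal_not_martingale :
  [/\ forall t, sub_measurable (F t.+1) (B t.+1),
      forall t, sub_measurable (F t) (beta t.+1),
      forall t w, - wealth B beta t w <= beta t.+1 w,
      forall t, cond_exp_eq P (F t) (EFin \o B t.+1) (cst 1%E) &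
      ~ martingale P F (penalized_wealth B beta)].
Proof.
split.
- by move=> t; exact: measurable_cst.
- by move=> t; exact: measurable_cst.
- case=> [|t] w; first by rewrite /= /beta.
  suff -> : wealth B beta t.+1 w = 0 by rewrite oppr0.
  elim: t => [|t IH]; first by rewrite /= /beta /= subrr mul0r.
  by rewrite [LHS]/= -/(wealth B beta t.+1 w) IH /beta /= addr0 mul0r.
- move=> t; exists (cst 1%E); last exact: aeW.
  by split; first exact: measurable_cst.
- case=> _ _ /(_ 0%N) [Y [mY /(_ setT)]].
  have [sF FT _] := hF.
  have FT0 : F 0%N setT.
    by have [F0 FC _] := sF 0%N; rewrite -(setD0 setT); exact: FC.
  move=> /(_ FT0) intY YM.
  have mY' : measurable_fun [set: T] Y.
    move=> _ V mV; apply: (FT 0%N); rewrite -[F 0%N](sigma_algebra_id (sF 0%N)).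
    exact: mY.
  have : (\int[P]_w Y w = \int[P]_w (cst 1 w))%E.
    apply: ae_eq_integral => //.
    by apply: filterS YM => w -> _; rewrite /penalized_wealth /= inve1 mule1.
  have int1 : (\int[P]_w (cst 1 w) = 1)%E.
    by rewrite integral_cst// mul1e; exact: probability_setT.
  rewrite intY int1 integral0_eq => [/eqP|w _].
    by rewrite eq_sym onee_eq0.
  by rewrite /penalized_wealth /= /beta /= subrr mul0r mul0e.
Qed.

End full_withdrawal.

(* Main.v *)
Require Import Defs.
From HB Require Import structures.
From mathcomp Require Import all_boot all_order all_algebra.
From mathcomp Require Import all_classical all_reals all_analysis.
From mathcomp Require Import measurable_realfun.
From mathcomp Require Import ring.

(** Dividing by the leverage penalty undoes the borrowing.  While the wealth is
positive, one round multiplies W by rho * B and the penalty by rho, so the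
quotient M = W / P is multiplied by B alone.  Once the wealth has been emptied,
by B = 0 or by a full withdrawal beta = - W, the conventions on 0 and infinity
keep M at 0, even if money is borrowed again later.  Both cases are covered by
the identity [penalized_wealthS]
    M (t + 1) = M t * 1{0 < W t + beta (t + 1)} * B (t + 1),
which also shows that M is finite and nonnegative.

The first two factors are F t-measurable and nonnegative, so they can be pulled
out of the conditional expectation given F t ([is_cond_expM], by monotone
approximation with F t-measurable simple functions).  Under E(B | F t) <= 1 this
gives E(M (t + 1) | F t) <= M t.  Under E(B | F t) = 1 it gives
M t * 1{0 < W t + beta (t + 1)}, which is M t almost surely when the wealth is
not entirely withdrawn while M t is positive.

The bound on the crossing probability is the inequality of Ville for the
nonnegative supermartingale M, whose initial value is 1 ([ville]), because the
crossings of P / alpha by W are those of 1 / alpha by M. *)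

Set Implicit Arguments.
Unset Strict Implicit.
Unset Printing Implicit Defensive.

Import Order.TTheory GRing.Theory Num.Theory.
Import numFieldNormedType.Exports.

Local Open Scope classical_set_scope.
Local Open Scope ring_scope.
Local Open Scope ereal_scope.

(** * Measurability with respect to a sub-sigma-algebra *)

Section sub_sigma_algebra.
Context d (T : measurableType d) (G : set (set T)).
Hypothesis sG : sigma_algebra setT G.

Lemma sub_sigma_algebraT : G setT.
Proof. by case: sG => G0 GC _; rewrite -(setD0 setT); exact: GC. Qed.

Lemma sub_sigma_algebraC A : G A -> G (~` A).
Proof. by case: sG => _ GC _ GA; rewrite -setTD; exact: GC. Qed.

Lemma sub_sigma_algebraI A A' : G A -> G A' -> G (A `&` A').
Proof.
move: (sigma_algebra_id sG) => <- mA mA'.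
exact: (@measurableI _ (g_sigma_algebraType G)).
Qed.

Lemma sub_measurable_preimage d' (U : measurableType d') (f : T -> U) V :
  sub_measurable G f -> measurable V -> G (f @^-1` V).
Proof.
by move=> mf mV; rewrite -(sigma_algebra_id sG) -[_ @^-1` _]setTI; exact: mf.
Qed.

Lemma sub_measurableW d' (U : measurableType d') (f : T -> U) :
  G `<=` measurable -> sub_measurable G f -> measurable_fun setT f.
Proof.
by move=> GT mf _ V mV; rewrite setTI; apply/GT/sub_measurable_preimage.
Qed.

End sub_sigma_algebra.

Lemma sub_measurable_subset d (T : measurableType d) (G G' : set (set T))
    d' (U : measurableType d') (f : T -> U) :
  G `<=` G' -> sub_measurable G f -> sub_measurable G' f.
Proof.
move=> GG' mf _ V mV; apply: (sub_sigma_algebra2 GG').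
exact: (mf measurableT V mV).
Qed.

(** * Conditional expectation of nonnegative variables *)

Section conditional_expectation_facts.
Context d (T : measurableType d) (R : realType) (P : probability T R).
Variable G : set (set T).
Hypotheses (sG : sigma_algebra setT G) (GT : G `<=` measurable).

Lemma is_cond_exp_ae_eq (X Y Y' : T -> \bar R) :
  is_cond_exp P G X Y -> sub_measurable G Y' ->
  {ae P, forall w, Y w = Y' w} -> is_cond_exp P G X Y'.
Proof.
move=> [mY YX] mY' YY'; split=> // A GA; rewrite -YX//; apply: ae_eq_integral.
- exact: GT.
- exact/measurable_funTS/(sub_measurableW sG GT).
- exact/measurable_funTS/(sub_measurableW sG GT).
- by apply: filterS YY' => w ->.
Qed.

(** A version of the conditional expectation is only constrained through its
integrals; negativity on a set of G with positive probability would make the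
integral of X over that set negative. *)
Lemma is_cond_exp_ge0 (X Y : T -> \bar R) :
  (forall w, 0 <= X w) -> is_cond_exp P G X Y -> {ae P, forall w, 0 <= Y w}.
Proof.
move=> X0 [mY YX]; pose A := Y @^-1` [set y | y < 0].
have GA : G A.
  apply: sub_measurable_preimage => //.
  by rewrite -[X in measurable X]setTI; exact: emeasurable_fun_infty_o.
have mA : measurable A by exact: GT.
have mYA : measurable_fun A Y.
  exact/measurable_funTS/(sub_measurableW sG GT).
(* The integral of Y over A is at most 0 by the choice of A and at least 0
   because it is that of X, so Y vanishes almost everywhere on A. *)
have : ae_eq P A Y (cst 0).
  apply/ae_eq_integral_abs => //; apply/eqP; rewrite eq_le; apply/andP; split.
    have -> : \int[P]_(w in A) `|Y w| = \int[P]_(w in A) - Y w.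
      by apply: eq_integral => w; rewrite inE => /ltW/lee0_abs.
    have -> : \int[P]_(w in A) - Y w = - \int[P]_(w in A) Y w.
      apply: oppe_inj; rewrite oppeK -integral_ge0N => [|w /ltW].
        by apply: eq_integral => w _; rewrite oppeK.
      by rewrite oppe_ge0.
    by rewrite YX// oppe_le0 integral_ge0.
  exact: integral_ge0.
apply: filterS => w YA; rewrite leNgt; apply/negP => Yw0.
by have := Yw0; rewrite (YA Yw0)/= ltxx.
Qed.

(** An extended-real version could be infinite or negative on a null set;
clamping it between 0 and c gives a real version, for which products and limits
need no side condition. *)
Lemma cond_exp_le_bounded (X : T -> \bar R) (c : R) :
  (0 <= c)%R -> (forall w, 0 <= X w) -> cond_exp_le P G X (cst c%:E) ->
  exists2 Y : T -> R, forall w, (0 <= Y w <= c)%R &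
    is_cond_exp P G X (EFin \o Y).
Proof.
move=> c0 X0 [Y cY Yc]; have Y0 := is_cond_exp_ge0 X0 cY.
pose Z w := mine (maxe (Y w) 0) c%:E.
have Z0 w : 0 <= Z w by rewrite le_min le_max lexx orbT lee_fin.
have Zc w : Z w <= c%:E by rewrite ge_min lexx orbT.
have ZE w : (fine (Z w))%:E = Z w.
  by apply: fineK; rewrite ge0_fin_numE// (le_lt_trans (Zc w)) ?ltry.
exists (fine \o Z) => [w|]; first by rewrite -!lee_fin /= ZE Z0 Zc.
have -> : EFin \o (fine \o Z) = Z by apply/funext => w; exact: ZE.
have [mY _] := cY; apply: is_cond_exp_ae_eq cY _ _.
  by apply: measurable_mine => //; exact: measurable_maxe.
by near=> w; rewrite /Z max_l ?min_l//; near: w.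
Unshelve. all: by end_near. Qed.

(** The form in which the supermartingale property is used, for the
integrability of M and for the inequality of Ville.  The version Y of the
conditional expectation is replaced with its positive part, so that only
integrals of nonnegative functions are compared. *)
Lemma cond_exp_le_integral (X Z : T -> \bar R) (A : set T) :
  (forall w, 0 <= X w) -> (forall w, 0 <= Z w) -> sub_measurable G Z ->
  cond_exp_le P G X Z -> G A ->
  \int[P]_(w in A) X w <= \int[P]_(w in A) Z w.
Proof.
move=> X0 Z0 mZ [Y cY YZ] GA; have mA : measurable A by exact: GT.
have Y0 := is_cond_exp_ge0 X0 cY.
have [mY _] := cY.
have [mY' YX] : is_cond_exp P G X (fun w => maxe (Y w) 0).
  apply: (is_cond_exp_ae_eq cY); first exact: measurable_maxe.
  by apply: filterS Y0 => w Yw; rewrite max_l.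
rewrite -YX//; apply: ae_ge0_le_integral => //.
- by move=> w _; rewrite le_max lexx orbT.
- exact/measurable_funTS/(sub_measurableW sG GT).
- exact/measurable_funTS/(sub_measurableW sG GT).
- by apply: filterS YZ => w YZw _; rewrite ge_max YZw Z0.
Qed.

End conditional_expectation_facts.

Section pull_out.
Context d (T : measurableType d) (R : realType) (P : probability T R).
Variable G : set (set T).
Hypotheses (sG : sigma_algebra setT G) (GT : G `<=` measurable).

Import HBNNSimple.

(** The integral over A of a simple function of G times X only depends on the
integrals of X over sets of G, namely the intersections of A with the level
sets of g. *)
Let integral_nnsfunM (g : {nnsfun g_sigma_algebraType G >-> R}) (X : T -> R)
    (A : set T) :
  G A -> (forall w, (0 <= X w)%R) -> measurable_fun setT X ->
  \int[P]_(w in A) ((g w)%:E * (X w)%:E) =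
  \sum_(y \in range g) y%:E * \int[P]_(w in A `&` g @^-1` [set y]) (X w)%:E.
Proof.
move=> GA X0 mX; have mA := GT GA.
have Gg y : G (g @^-1` [set y]).
  by apply: sub_measurable_preimage => //; exact: measurable_funP.
have mg y : measurable (g @^-1` [set y] : set T) by exact: GT.
have m1 y : measurable_fun A (fun w => \1_(g @^-1` [set y]) w * X w)%R.
  exact/measurable_funTS/measurable_funM.
transitivity (\int[P]_(w in A) \sum_(y \in range g)
    (y * \1_(g @^-1` [set y]) w)%:E * (X w)%:E).
  apply: eq_integral => w _; rewrite fimfunE -fsumEFin//.
  by rewrite -ge0_mule_fsuml// => y; exact: nnfun_muleindic_ge0.
rewrite ge0_integral_fsum//; last 2 first.
- move=> y; under eq_fun do rewrite -EFinM -mulrA.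
  exact/measurable_EFinP/measurable_funM.
- move=> y w _; apply: mule_ge0; last by rewrite lee_fin.
  exact: nnfun_muleindic_ge0.
apply: eq_fsbigr => y; rewrite inE => -[w0 _ <-].
under eq_integral do rewrite -EFinM -mulrA EFinM.
rewrite ge0_integralZl ?lee_fin//; last 2 first.
- exact/measurable_EFinP.
- by move=> w _; rewrite lee_fin mulr_ge0.
congr (_ * _); rewrite integral_mkcondr; apply: eq_integral => w _.
by rewrite epatch_indic EFinM muleC.
Qed.

(** What is known can be taken out of the conditional expectation.  X and Y
have the same integrals over the sets of G, hence the same integrals against
simple functions of G, hence against h by monotone convergence. *)
Lemma is_cond_expM (h X Y : T -> R) :
  (forall w, (0 <= h w)%R) -> sub_measurable G h ->
  (forall w, (0 <= X w)%R) -> measurable_fun setT X ->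
  (forall w, (0 <= Y w)%R) ->
  is_cond_exp P G (EFin \o X) (EFin \o Y) ->
  is_cond_exp P G (fun w => (h w)%:E * (X w)%:E)
                  (fun w => (h w)%:E * (Y w)%:E).
Proof.
move=> h0 mh X0 mX Y0 [/measurable_EFinP mY YX]; split=> [|A GA].
  exact/measurable_EFinP/measurable_funM.
have mEh : measurable_fun [set: g_sigma_algebraType G] (EFin \o h).
  exact/measurable_EFinP.
pose g := nnsfun_approx measurableT mEh.
have mgT n : measurable_fun [set: T] (g n).
  by apply: (sub_measurableW sG GT); exact: measurable_funP.
have intE (Z : T -> R) : (forall w, (0 <= Z w)%R) -> measurable_fun setT Z ->
    \int[P]_(w in A) ((h w)%:E * (Z w)%:E) =
    limn (fun n => \int[P]_(w in A) ((g n w)%:E * (Z w)%:E)).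
  move=> Z0 mZ; rewrite -monotone_convergence//=.
  - apply: eq_integral => w _; apply/esym/cvg_lim => //.
    apply: cvgeZr => //; apply: cvg_nnsfun_approx => // w' _.
    by rewrite lee_fin.
  - exact: GT.
  - move=> n; apply: measurable_funTS.
    exact/measurable_EFinP/measurable_funM.
  - by move=> n w _; rewrite mule_ge0 ?lee_fin.
  - move=> w _ m n mn; rewrite lee_wpmul2r ?lee_fin//.
    by have /lefP := nd_nnsfun_approx measurableT mEh mn; exact.
have mYT : measurable_fun setT Y by exact: sub_measurableW mY.
rewrite !intE//; congr (limn _); apply/funext => n.
rewrite !integral_nnsfunM//; apply: eq_fsbigr => y _; congr (_ * _).
apply: YX; apply: sub_sigma_algebraI => //.
by apply: sub_measurable_preimage => //; exact: measurable_funP.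
Qed.

End pull_out.

(** * The inequality of Ville *)

Section ville.
Context d (T : measurableType d) (R : realType) (P : probability T R).
Variables (F : nat -> set (set T)) (M : nat -> T -> \bar R).
Hypotheses (hF : is_filtration F) (sM : supermartingale P F M).
Hypothesis M_ge0 : forall t w, 0 <= M t w.

Let sF t : sigma_algebra setT (F t). Proof. by case: hF. Qed.
Let FT t : F t `<=` measurable. Proof. by case: hF. Qed.
Let mM t : measurable_fun setT (M t).
Proof.
by case: sM => aM _ _; exact: (sub_measurableW (sF t) (@FT t) (aM t)).
Qed.

Let crossed (c : R) n := [set w | exists2 t, (t <= n)%N & c%:E <= M t w].

Let crossedS c n :
  crossed c n.+1 = crossed c n `|` [set w | c%:E <= M n.+1 w].
Proof.
apply/seteqP; split=> w.
  move=> [t]; rewrite leq_eqVlt => /predU1P[->|tn] ct; first by right.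
  by left; exists t.
by move=> [[t tn ct]|cn]; [exists t => //; exact: leqW|exists n.+1].
Qed.

Let F_level (c : R) t : F t [set w | c%:E <= M t w].
Proof.
case: sM => aM _ _.
apply: (sub_measurable_preimage (sF t) (V := [set y | c%:E <= y])) => //.
by rewrite -[X in measurable X]setTI; exact: emeasurable_fun_c_infty.
Qed.

Let F_crossed c n : F n (crossed c n).
Proof.
elim: n => [|n IH].
  have -> : crossed c 0 = [set w | c%:E <= M 0%N w] by
    apply/seteqP; split=> w => [[t]|c0]; [rewrite leqn0 => /eqP ->|exists 0%N].
  exact: F_level.
rewrite crossedS; have [_ _ incF] := hF.
rewrite -(sigma_algebra_id (sF n.+1)).
apply: (@measurableU _ (g_sigma_algebraType (F n.+1))).
  by rewrite /measurable/= sigma_algebra_id//; exact: incF IH.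
by rewrite /measurable/= sigma_algebra_id//; exact: F_level.
Qed.

(** By induction on n, c times the probability of having crossed c by time n,
plus the integral of M n over the paths that have not crossed, is at most the
expectation of M 0: it is a bound for the expectation of M stopped at the first
crossing.  Dropping the second term and letting n go to infinity gives the
result. *)
Lemma ville (c : R) : (0 <= c)%R ->
  c%:E * P [set w | exists t, c%:E <= M t w] <= \int[P]_w M 0%N w.
Proof.
move=> c0.
have mC n : measurable (crossed c n) by exact: FT (F_crossed c n).
have mL t : measurable [set w | c%:E <= M t w] by exact: FT (F_level c t).
have level_le (A : set T) t :
    measurable A -> (forall w, A w -> c%:E <= M t w) ->
    c%:E * P A <= \int[P]_(w in A) M t w.
  move=> mA cM; rewrite -integral_cst//; apply: ge0_le_integral => //.
  exact: measurable_funTS.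
have step n : c%:E * P (crossed c n) + \int[P]_(w in ~` crossed c n) M n w
    <= \int[P]_w M 0%N w.
  have split_int (C A : set T) t : measurable A -> measurable C ->
      \int[P]_(w in C) M t w =
      \int[P]_(w in C `&` A) M t w + \int[P]_(w in C `&` ~` A) M t w.
    move=> mA mC'; rewrite -ge0_integral_setU//.
    - by rewrite -setIUr setUv setIT.
    - exact: measurableI.
    - by apply: measurableI; [by []|exact: measurableC].
    - exact: measurable_funTS.
    - by rewrite disj_set2E; apply/eqP/seteqP; split=> // w [[_ Aw] [_]].
  elim: n => [|n IH].
    rewrite (split_int setT (crossed c 0))// !setTI leeD2r//.
    by apply: level_le => // w [t]; rewrite leqn0 => /eqP ->.
  (* On the paths that have not crossed by time n, replacing M n with M (n + 1)
     does not increase the integral; those that cross at time n + 1 are then moved to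
     the first term. *)
  apply: le_trans IH; set L := [set w | c%:E <= M n.+1 w].
  have mLn : measurable L by exact: mL.
  have -> : P (crossed c n.+1) = P (crossed c n) + P (~` crossed c n `&` L).
    rewrite -measureU//; last 2 first.
    - by apply: measurableI; [exact: measurableC|exact: mL].
    - by rewrite setIA setICr set0I.
    congr (P _); rewrite crossedS; apply/seteqP; split=> w.
      move=> [|Lw]; first by left.
      by have [|nCw] := pselect (crossed c n w); [left|right].
    by move=> [|[_ Lw]]; [left|right].
  have -> : ~` crossed c n.+1 = ~` crossed c n `&` ~` L.
    by rewrite crossedS setCU.
  rewrite ge0_muleDr// -addeA leeD2l//.
  case: sM => aM _ cM.
  apply: le_trans (cond_exp_le_integral (sF n) (@FT n) (M_ge0 n.+1) (M_ge0 n)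
    (aM n) (cM n) (sub_sigma_algebraC (sF n) (F_crossed c n))).
  rewrite [leRHS](split_int _ L)//; last exact: measurableC.
  rewrite leeD2r//; apply: level_le => [|w []//].
  by apply: measurableI; [exact: measurableC|by []].
have -> : [set w | exists t, c%:E <= M t w] = \bigcup_n crossed c n.
  apply/seteqP; split=> w => [[t ct]|[n _ [t _ ct]]]; last by exists t.
  by exists t => //; exists t.
have cvgP :
    c%:E * P (crossed c n) @[n --> \oo] --> c%:E * P (\bigcup_n crossed c n).
  apply: cvgeZl => //; apply: nondecreasing_cvg_mu => //.
    exact: bigcupT_measurable.
  move=> n m nm; apply/subsetPset => w [t tn ct].
  by exists t => //; exact: leq_trans nm.
rewrite -(cvg_lim _ cvgP)//; apply: lime_le.
  by apply/cvg_ex; eexists; exact: cvgP.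
apply: nearW => n; apply: le_trans (step n).
by rewrite leeDl// integral_ge0.
Qed.

End ville.

(** * Pathwise evolution of the penalized wealth *)

Section penalized_wealth_facts.
Context (T : Type) (R : realType) (B beta : nat -> T -> R).
Hypothesis B_ge0 : forall t w, (0 <= B t.+1 w)%R.
Hypothesis beta_ge : forall t w, (- wealth B beta t w <= beta t.+1 w)%R.
Local Notation W := (wealth B beta).
Local Notation M := (penalized_wealth B beta).

(** The leverage ratio enters the wealth and the penalty alike and cancels,
unless it is 0.  If W t = 0 both sides are 0, and if the penalty is already
infinite, after a borrowing from zero wealth, both sides are 0 as well. *)
Lemma penalized_wealthS t w :
  M t.+1 w = M t w * ((0 < W t w + beta t.+1 w)%R%:R * B t.+1 w)%:E.
Proof.
have [W0|Wn0] := eqVneq (W t w) 0%R.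
  by rewrite !(penalized_wealth_stays0 beta_ge W0)// mul0e.
have W0 : (0 < W t w)%R by rewrite lt_neqAle eq_sym Wn0 wealth_ge0.
have := wealthD_ge0 beta_ge t w; rewrite le_eqVlt => /predU1P[Wb0|Wb0].
  rewrite -Wb0 ltxx mul0r mule0.
  by rewrite (penalized_wealth_stays0 beta_ge _ (leqnn _))//= -Wb0 mul0r.
rewrite Wb0 mul1r /penalized_wealth /= /lev_mul /leverage /lev_div /=.
rewrite (gt_eqF Wb0) /= inver (negPf Wn0) -EFinM.
have := penalty_ge0 B_ge0 beta_ge t w.
have : penalty B beta t w != 0.
  by apply: contra_neq Wn0; exact: wealth_eq0_of_penalty.
case: (penalty B beta t w) => [p| |]//=; last first.
  by rewrite invey !mule0 mul0e.
rewrite eqe lee_fin => pn0 p0.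
rewrite -EFinM !inver (negPf pn0) mulf_eq0 mulf_eq0 (negPf pn0) invr_eq0.
rewrite (negPf Wn0) (gt_eqF Wb0)/= -!EFinM; congr EFin.
by field; rewrite pn0 Wn0 gt_eqF.
Qed.

Lemma penalized_wealth_fin_num t w : M t w \is a fin_num.
Proof.
elim: t => [|t IH]; first by rewrite /penalized_wealth /= inve1 mule1.
by rewrite penalized_wealthS fin_numM.
Qed.

Lemma penalized_wealth_ge0 t w : 0 <= M t w.
Proof.
elim: t => [|t IH]; first by rewrite /penalized_wealth /= inve1 mule1.
by rewrite penalized_wealthS mule_ge0// lee_fin mulr_ge0.
Qed.

End penalized_wealth_facts.

(** * The penalized wealth as a stochastic process *)

Section penalized_wealth_cond_exp.
Context d (T : measurableType d) (R : realType) (P : probability T R).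
Variables (F : nat -> set (set T)) (B beta : nat -> T -> R).
Hypothesis hF : is_filtration F.
Hypothesis B_ge0 : forall t w, (0 <= B t.+1 w)%R.
Hypothesis B_adapted : forall t, sub_measurable (F t.+1) (B t.+1).
Hypothesis beta_predictable : forall t, sub_measurable (F t) (beta t.+1).
Hypothesis beta_ge : forall t w, (- wealth B beta t w <= beta t.+1 w)%R.
Local Notation W := (wealth B beta).
Local Notation M := (penalized_wealth B beta).

Let adaptedS d' (U : measurableType d') (f : T -> U) t :
  sub_measurable (F t) f -> sub_measurable (F t.+1) f.
Proof. by have [_ _ incF] := hF; apply: sub_measurable_subset; exact: incF. Qed.

Lemma wealth_adapted t : sub_measurable (F t) (W t).
Proof.
elim: t => [|t IH]; first exact: measurable_cst.
have mWb : sub_measurable (F t) (fun w => W t w + beta t.+1 w)%R.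
  exact: measurable_funD IH (@beta_predictable t).
exact: measurable_funM (adaptedS mWb) (@B_adapted t).
Qed.

Let invested t w : R := (0 < W t w + beta t.+1 w)%R%:R.

Let invested_adapted t : sub_measurable (F t) (invested t).
Proof.
rewrite /invested.
have -> : (fun w => (0 < W t w + beta t.+1 w)%R%:R) =
    (fun w => if (0 < W t w + beta t.+1 w)%R then 1 else 0)%R :> (T -> R).
  by apply/funext => w; case: ifP.
apply: measurable_fun_ifT; [|exact: measurable_cst..].
apply: measurable_fun_ltr; first exact: measurable_cst.
exact: measurable_funD (@wealth_adapted t) (@beta_predictable t).
Qed.

Lemma penalized_wealth_adapted t : sub_measurable (F t) (M t).
Proof.
elim: t => [|t IH].
  rewrite /penalized_wealth /= inve1.
  exact: measurable_cst.
have -> : M t.+1 = M t \* (EFin \o (fun w => (invested t w * B t.+1 w)%R)).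
  by apply/funext => w; rewrite penalized_wealthS.
apply: emeasurable_funM; first exact: adaptedS.
apply/measurable_EFinP/measurable_funM; last exact: B_adapted.
exact: (adaptedS (@invested_adapted t)).
Qed.

(** Whether money remains for the bet at time t + 1 is known at time t, so in
the evolution of M only the bet is averaged. *)
Lemma penalized_wealth_cond_exp t (Y : T -> R) :
  (forall w, (0 <= Y w)%R) ->
  is_cond_exp P (F t) (EFin \o B t.+1) (EFin \o Y) ->
  is_cond_exp P (F t) (M t.+1)
    (fun w => M t w * ((0 < W t w + beta t.+1 w)%R%:R * Y w)%:E).
Proof.
move=> Y0 BY; have [sF FT _] := hF.
pose h w := (fine (M t w) * invested t w)%R.
have hE Z : (fun w => M t w * (invested t w * Z w)%:E) =
            (fun w => (h w)%:E * (Z w)%:E).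
  apply/funext => w; rewrite /h !EFinM muleA fineK//.
  exact: penalized_wealth_fin_num.
have -> : M t.+1 = fun w => (h w)%:E * (B t.+1 w)%:E.
  by rewrite -hE; apply/funext => w; rewrite penalized_wealthS.
rewrite hE; apply: is_cond_expM => //.
- by move=> w; rewrite /h mulr_ge0// fine_ge0// penalized_wealth_ge0.
- apply: measurable_funM (@invested_adapted t).
  apply: measurableT_comp; last exact: penalized_wealth_adapted.
  exact: fine_measurable.
- exact: (sub_measurableW (sF t.+1) (FT t.+1) (@B_adapted t)).
Qed.

Lemma integral_penalized_wealth0 : \int[P]_w M 0%N w = 1.
Proof.
under eq_integral do rewrite /penalized_wealth /= inve1 mule1.
rewrite integral_cst// mul1e; exact: probability_setT.
Qed.

(** M is nonnegative and its expectation, initially 1, does not increase. *)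
Lemma penalized_wealth_integrable :
  (forall t, cond_exp_le P (F t) (M t.+1) (M t)) ->
  forall t, P.-integrable setT (M t).
Proof.
move=> cM t; have [sF FT _] := hF; apply/integrableP; split.
  exact: (sub_measurableW (sF t) (FT t) (@penalized_wealth_adapted t)).
under eq_integral do rewrite gee0_abs ?penalized_wealth_ge0//.
apply: (@le_lt_trans _ _ 1); last exact: ltry.
elim: t => [|t IH]; first by rewrite integral_penalized_wealth0.
apply: le_trans IH; apply: (cond_exp_le_integral (sF t) (FT t)) => //.
- by move=> w; exact: penalized_wealth_ge0.
- by move=> w; exact: penalized_wealth_ge0.
- exact: penalized_wealth_adapted.
- exact: sub_sigma_algebraT.
Qed.

Lemma penalized_wealth_supermartingale :
  (forall t, cond_exp_le P (F t) (EFin \o B t.+1) (cst 1)) ->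
  supermartingale P F M.
Proof.
move=> Bnull; have [sF FT _] := hF.
have M0 t w : 0 <= M t w by exact: penalized_wealth_ge0.
have cM t : cond_exp_le P (F t) (M t.+1) (M t).
  have [//|w|Y Y01 cY] := cond_exp_le_bounded (sF t) (FT t) _ _ (Bnull t).
    by rewrite lee_fin.
  have Y0 w : (0 <= Y w)%R by have /andP[] := Y01 w.
  exists (fun w => M t w * ((0 < W t w + beta t.+1 w)%R%:R * Y w)%:E).
    exact: penalized_wealth_cond_exp.
  apply: aeW => w; rewrite -[leRHS]mule1 lee_wpmul2l// lee_fin.
  by rewrite mulr_ile1//; [case: ltP|have /andP[] := Y01 w].
split=> //; first exact: penalized_wealth_adapted.
exact: penalized_wealth_integrable.
Qed.

Lemma penalized_wealth_martingale :
  (forall t, cond_exp_eq P (F t) (EFin \o B t.+1) (cst 1)) ->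
  (forall t, {ae P, forall w, 0 < M t w -> (- W t w < beta t.+1 w)%R}) ->
  martingale P F M.
Proof.
move=> Bnull Mbeta; have [sF FT _] := hF.
have cM t : cond_exp_eq P (F t) (M t.+1) (M t).
  exists (fun w => M t w * ((0 < W t w + beta t.+1 w)%R%:R * 1)%:E).
    apply: (penalized_wealth_cond_exp (Y := cst 1%R)) => //.
    have [Y cY Y1] := Bnull t.
    apply: (is_cond_exp_ae_eq (sF t) (FT t) cY _ Y1).
    exact: measurable_cst.
  (* Where M t = 0 the identity holds whatever has been withdrawn. *)
  apply: filterS (Mbeta t) => w; rewrite mulr1.
  have := penalized_wealth_ge0 B_ge0 beta_ge t w.
  rewrite le_eqVlt => /predU1P[<-|M0 /(_ M0)]; first by rewrite mul0e.
  by rewrite -subr_gt0 opprK addrC => ->; rewrite mule1.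
split=> //; first exact: penalized_wealth_adapted.
apply: penalized_wealth_integrable => t; have [Y cY YM] := cM t.
by exists Y => //; apply: filterS YM => w ->.
Qed.

End penalized_wealth_cond_exp.

Theorem theorem4p2 (R : realType) (d : measure_display) (T : measurableType d)
    (P : probability T R) (F : nat -> set (set T)) (B beta : nat -> T -> R)
    (hF : is_filtration F)
    (B_ge0 : forall t w, (0 <= B t.+1 w)%R)
    (B_adapted : forall t, sub_measurable (F t.+1) (B t.+1))
    (beta_predictable : forall t, sub_measurable (F t) (beta t.+1))
    (beta_ge : forall t w, (- wealth B beta t w <= beta t.+1 w)%R) :
  let W := wealth B beta in
  let Pen := penalty B beta in
  let M := penalized_wealth B beta in
  let supermartingale_null :=
    forall t, cond_exp_le P (F t) (EFin \o B t.+1) (cst 1) in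
  let martingale_null :=
    forall t, cond_exp_eq P (F t) (EFin \o B t.+1) (cst 1) in
  [/\ supermartingale_null ->
        (forall t w, 0 <= M t w) /\ supermartingale P F M,
      martingale_null ->
        (* Withdrawing all the wealth sends M to 0 whatever the bet, so this is
           excluded, see [full_withdrawal_not_martingale]. *)
        (forall t, {ae P, forall w,
           0 < M t w -> (- W t w < beta t.+1 w)%R}) ->
        martingale P F M &
      supermartingale_null ->
        forall alpha : R, (0 < alpha < 1)%R ->
          (* If Pen t w = 0 then W t w = 0 and the ratio is read as 0, so that
             the trivial inequality 0 >= 0 / alpha is not a crossing. *)
          P [set w | exists t,
               Pen t w != 0 /\ Pen t w / alpha%:E <= (W t w)%:E]
          <= alpha%:E].
Proof.
move=> W Pen M supermartingale_null martingale_null; split.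
- move=> Bnull; split=> [t w|]; first exact: penalized_wealth_ge0.
  exact: penalized_wealth_supermartingale.
- exact: penalized_wealth_martingale.
- move=> Bnull alpha /andP[a0 _].
  have sM := penalized_wealth_supermartingale hF B_ge0 B_adapted
    beta_predictable beta_ge Bnull.
  have M0 := penalized_wealth_ge0 B_ge0 beta_ge.
  have ai0 : (0 <= alpha^-1)%R by rewrite invr_ge0 ltW.
  rewrite (_ : [set w | _] = [set w | exists t, (alpha^-1)%:E <= M t w]).
    have := ville hF sM M0 ai0.
    by rewrite integral_penalized_wealth0 lee_pdivrMl// mule1.
  by apply/seteqP; split=> w [t] /(penalty_crossing B_ge0 beta_ge t w a0) ?;
    exists t.
Qed.
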